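(* Let $(X,\star)$ be a shelf with a subset $A\subset X$ on which $X$ acts from the right by permutations, i.e. $a\star x\in A$ whenever $a\in A$ and $x\in X$, and for every $x\in X$ the map $a\mapsto a\star x$ is a permutation of $A$. Then the augmented distributive chain complex $\widetilde C(X)$ is acyclic.
   Context: A shelf $(X,\star)$ is a set $X$ with a binary operation satisfying $(x\star y)\star z=(x\star z)\star(y\star z)$ for all $x,y,z\in X$. The one-term distributive chain complex $C(X)$ has $C_n(X)=\mathbb{Z}X^{n+1}$, the free abelian group on sequences $(x_0,\dots,x_n)$ of elements of $X$ ($n\geqslant 0$), with differential $\partial_n=\sum_{i=0}^n(-1)^id^i$, where $d^0(x_0,\dots,x_n)=(x_1,\dots,x_n)$ and $d^i(x_0,\dots,x_n)=(x_0\star x_i,\dots,x_{i-1}\star x_i,x_{i+1},\dots,x_n)$ for $i\geqslant 1$. The augmented complex $\widetilde C(X)$ has $\widetilde C_n(X)=C_n(X)$ for $n\geqslant0$ with the same differentials $\partial_n$ for $n\geqslant1$, $\widetilde C_{-1}(X)=\mathbb{Z}$ and $\partial_0(x)=1$ for all $x\in X$. Acyclic means that all homology groups (in degrees $\geqslant -1$) vanish.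
   Formalization: The subset A is assumed nonempty; for A empty the hypothesis is vacuous and the claim fails, e.g. for X with two elements and x⋆y = y, where the differential from degree 1 to degree 0 vanishes and the homology in degree 0 is nonzero. *)

(* Defs.v *)
From HB Require Import structures.
From mathcomp Require Import all_boot all_order all_algebra.
From mathcomp Require Import boolp classical_sets functions.
From mathcomp Require Import freeg.

Set Implicit Arguments.
Unset Strict Implicit.
Unset Printing Implicit Defensive.

Import GRing.Theory.
Local Open Scope ring_scope.

HB.mixin Record isShelf X of Choice X := {
  shelf_op : X -> X -> X;
  shelf_opDl : left_distributive shelf_op shelf_op
}.

#[short(type="shelfType")]
HB.structure Definition Shelf := {X of isShelf X & Choice X}.

Declare Scope shelf_scope.
Notation "x ⋆ y" := (shelf_op x y) (at level 40, left associativity) : shelf_scope.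
Local Open Scope shelf_scope.

(* Complexes are bounded below; the lowest term has index 0, whatever the
   degree it is given in a particular complex. *)
Record chain_complex := ChainComplex {
  chain : nat -> zmodType;
  bd : forall k, {additive chain k.+1 -> chain k};
  bdK : forall k (c : chain k.+2), bd k (bd k.+1 c) = 0
}.

Section Homology.
Variables (C : chain_complex) (k : nat).

Definition is_cycle : chain C k -> bool :=
  match k return chain C k -> bool with
  | 0 => fun=> true
  | k'.+1 => fun c => bd C k' c == 0
  end.

Lemma is_cycle_zmod_closed : zmod_closed is_cycle.
Proof.
rewrite /is_cycle; case: k => [|k'] //; split=> [|x y]; rewrite !unfold_in.
  by rewrite raddf0.
by move=> /eqP x0 /eqP y0; rewrite raddfB x0 y0 subr0.
Qed.

HB.instance Definition _ :=
  GRing.isZmodClosed.Build (chain C k) is_cycle is_cycle_zmod_closed.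

Record cycles := Cycle { cycle_val : chain C k; _ : is_cycle cycle_val }.

HB.instance Definition _ := [isSub for cycle_val].
HB.instance Definition _ := [Choice of cycles by <:].
HB.instance Definition _ := [SubChoice_isSubZmodule of cycles by <:].

Definition is_boundary (z : cycles) : bool :=
  `[< exists b : chain C k.+1, bd C k b = cycle_val z >].

Lemma is_boundary_zmod_closed : zmod_closed is_boundary.
Proof.
split=> [|x y]; rewrite !unfold_in.
  by apply/asboolP; exists 0; rewrite raddf0.
move=> /asboolP[b bx] /asboolP[c cy]; apply/asboolP; exists (b - c).
by rewrite raddfB bx cy.
Qed.

HB.instance Definition _ :=
  GRing.isZmodClosed.Build cycles is_boundary is_boundary_zmod_closed.

Definition homology : zmodType :=
  Quotient.quot (GRing.ZmodClosed.clone cycles is_boundary _).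

End Homology.

Definition acyclic (C : chain_complex) : Prop :=
  forall k (h : homology C k), h = 0.

Section Distributive.
Variable X : shelfType.

(* [lift i j] is [j] for [j < i] and [j.+1] otherwise; for [i = 0] no entry
   is multiplied. *)
Definition face n (i : 'I_n.+2) (x : n.+2.-tuple X) : n.+1.-tuple X :=
  [tuple let y := tnth x (fintype.lift i j) in
         if (j < i)%N then y ⋆ tnth x i else y | j < n.+1].

Definition dist_chain n : zmodType := {freeg (n.+1.-tuple X) / int}.

Definition dist_bd n : dist_chain n.+1 -> dist_chain n :=
  fglift (fun x : n.+2.-tuple X =>
    \sum_(i < n.+2) (-1) ^+ i *: (<< face i x >> : {freeg _ / int})).

Lemma dist_bd_is_zmod_morphism n : zmod_morphism (@dist_bd n).
Proof. exact: lift_is_additive. Qed.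

HB.instance Definition _ n :=
  GRing.isZmodMorphism.Build (dist_chain n.+1) (dist_chain n) (@dist_bd n)
    (@dist_bd_is_zmod_morphism n).

Lemma nth_face x0 n (i : 'I_n.+2) (x : n.+2.-tuple X) m : (m < n.+1)%N ->
  nth x0 (face i x) m =
    if (m < i)%N then nth x0 x m ⋆ nth x0 x i else nth x0 x m.+1.
Proof.
move=> mn; have -> : m = Ordinal mn by [].
rewrite -tnth_nth tnth_mktuple !(tnth_nth x0) /= /bump.
by case: leqP; rewrite ?add0n ?add1n.
Qed.

Lemma face_face n (j i : nat) (x : n.+3.-tuple X) :
  (j <= i)%N -> (i < n.+2)%N ->
  face (inord i) (face (inord j) x) = face (inord j) (face (inord i.+1) x).
Proof.
move=> ji iN; have jN := leq_ltn_trans ji iN; pose x0 := thead x.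
apply: val_inj; apply: (@eq_from_nth _ x0) => [|m]; rewrite ?size_tuple // => mn.
have mn1 := ltnW mn.
rewrite !nth_face ?inordK ?ltnS ?(ltnW iN) ?(ltnW jN) //.
rewrite ji (ltnNge i j) ji /=.
case: (ltnP m j) => [mj|jm]; last by rewrite (ltnNge m.+1 j) (leqW jm).
have mi : (m < i)%N by exact: leq_trans mj ji.
by rewrite mi (ltnW mi) shelf_opDl.
Qed.

Lemma dist_bdU n (x : n.+2.-tuple X) :
  dist_bd << x >> =
    \sum_(i < n.+2) (-1) ^+ i *: (<< face i x >> : {freeg _ / int}).
Proof. by rewrite /dist_bd liftU scale1r. Qed.

Lemma freeg_eq0 (K : choiceType) (V : zmodType)
    (f : {additive {freeg K / int} -> V}) :
  (forall x, f << x >> = 0) -> forall c, f c = 0.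
Proof.
move=> f0 c; rewrite -[c]freeg_sumE raddf_sum big1 // => x _.
by rewrite -[coeff x c]intz -freegU_mulz raddfMz f0 mul0rz.
Qed.

Lemma dist_bdZ n a c : @dist_bd n (a *: c) = a *: dist_bd c.
Proof. by rewrite -[a]intz !scaler_int raddfMz. Qed.

Lemma dist_bdK n c : @dist_bd n (@dist_bd n.+1 c) = 0.
Proof.
move: c; apply: (freeg_eq0 (f := @dist_bd n \o @dist_bd n.+1)) => x /=.
rewrite dist_bdU raddf_sum /=.
pose F (p : 'I_n.+3 * 'I_n.+2) : {freeg (n.+1.-tuple X) / int} :=
  (-1) ^+ (p.1 + p.2) *: << face p.2 (face p.1 x) >>.
rewrite (eq_bigr (fun i => \sum_(j < n.+2) F (i, j))); last first.
  move=> i _; rewrite dist_bdZ dist_bdU scaler_sumr; apply: eq_bigr => j _.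
  by rewrite scalerA -exprD.
rewrite pair_big /= (bigID (fun p : 'I_n.+3 * 'I_n.+2 => (p.1 <= p.2)%N)) /=.
pose h (p : 'I_n.+3 * 'I_n.+2) : 'I_n.+3 * 'I_n.+2 := (inord p.2.+1, inord p.1).
pose g (p : 'I_n.+3 * 'I_n.+2) : 'I_n.+3 * 'I_n.+2 := (inord p.2, inord p.1.-1).
apply/eqP; rewrite addrC addr_eq0 (reindex_onto h g) /=; last first.
  move=> [i j] /=; rewrite -ltnNge => ji; rewrite /h /g /=.
  have i0 : (0 < i)%N by exact: leq_ltn_trans ji.
  have i1 : (inord i.-1 : 'I_n.+2) = i.-1 :> nat.
    by rewrite inordK // -ltnS prednK.
  have j1 : (inord j : 'I_n.+3) = j :> nat by rewrite inordK // ltnS ltnW.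
  congr (_, _); apply: val_inj => /=; first by rewrite i1 prednK // inord_val.
  by rewrite j1 inord_val.
have jE (j : 'I_n.+2) : (inord j.+1 : 'I_n.+3) = j.+1 :> nat.
  by rewrite inordK // ltnS.
have iE (i : 'I_n.+3) : inord (inord i : 'I_n.+2) = i ->
    (inord i : 'I_n.+2) = i :> nat.
  by move/(congr1 val) => /=; rewrite inordK // ltnW // ltnS.
rewrite -sumrN; apply/eqP; apply: eq_big => [[i j]|[i j]].
  rewrite /g /h /= jE -ltnNge ltnS inord_val.
  apply/andP/idP => [[ij /eqP[/iE iN]]|ij]; first by rewrite -iN.
  have iN : (inord i : 'I_n.+2) = i :> nat.
    by rewrite inordK // (leq_ltn_trans ij).
  by rewrite iN ij inord_val.
rewrite /g /h /F /= jE -ltnNge ltnS inord_val => /andP[ij /eqP[/iE iN]].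
rewrite -scaleNr iN addSn exprS mulN1r addnC; congr (- _ *: << _ >>).
by rewrite iN in ij; rewrite -(face_face x ij (ltn_ord j)) !inord_val.
Qed.

Definition aug_chain (k : nat) : zmodType :=
  if k is n.+1 then dist_chain n else int.

Definition aug_bd k : {additive aug_chain k.+1 -> aug_chain k} :=
  match k return {additive aug_chain k.+1 -> aug_chain k} with
  | 0 => @deg (1.-tuple X)
  | n.+1 => @dist_bd n
  end.

Lemma aug_bdK k (c : aug_chain k.+2) : aug_bd k (aug_bd k.+1 c) = 0.
Proof.
case: k c => [|n] /= c; last exact: dist_bdK.
move: c; apply: (freeg_eq0 (f := @deg _ \o @dist_bd 0)) => x /=.
rewrite dist_bdU !big_ord_recl big_ord0 addr0 expr0 expr1 scale1r scaleN1r.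
by rewrite degD degN !degU subrr.
Qed.

(* The term of index [k] sits in degree [k - 1]. *)
Definition augmented_complex : chain_complex := ChainComplex aug_bdK.

End Distributive.

(* Main.v *)
Require Import Defs.
From HB Require Import structures.
From mathcomp Require Import all_boot all_order all_algebra.
From mathcomp Require Import boolp classical_sets functions.
From mathcomp Require Import freeg.

(** The augmented complex is contracted by coning each sequence off from a
point of A that is chosen to depend on the sequence.  Prefixing a sequence
x = (x_0, ..., x_n) with an element b of X gives (b, x), whose 0th face is x
and whose (i+1)st face is d^i x prefixed with b ⋆ x_i.  With a fixed b this
would not give a homotopy, because b moves.  Choose instead a function apex
from sequences to X with

      apex(x) ⋆ x_i = apex(d^i x)   for every x and i,

and put h(x) = (apex(x), x): the faces of h(x) are then x and the h(d^i x), so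
that ∂h + h∂ = id ([cone_homotopy]) and all cycles are boundaries
([acyclic_contraction]).

Such a function exists because X permutes A ([exists_apex]).  Fix a in A and
let apex(x) be the unique element b of A with
(...((b ⋆ x_0) ⋆ x_1) ...) ⋆ x_n = a.  By self-distributivity the total
action of d^i x on b ⋆ x_i equals the total action of x on b
([foldl_face]); so apex(x) ⋆ x_i and apex(d^i x) are elements of A which
d^i x sends to the same point a, and they coincide. *)

Set Implicit Arguments.
Unset Strict Implicit.
Unset Printing Implicit Defensive.

Import GRing.Theory.
Local Open Scope ring_scope.
Local Open Scope classical_set_scope.
Local Open Scope shelf_scope.

Lemma acyclic_contraction (C : chain_complex)
    (s : forall k, {additive chain C k -> chain C k.+1}) :
  (forall c, bd C 0 (s 0 c) = c) ->
  (forall k c, bd C k.+1 (s k.+1 c) + s k (bd C k c) = c) ->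
  acyclic C.
Proof.
move=> s0 sS k h; rewrite -[h]reprK.
set z := repr h.
have zB : is_boundary z.
  apply/asboolP; exists (s k (cycle_val z)).
  case: z => c; case: k h c => [|k] h c cz /=; first exact: s0.
  by have := sS k c; rewrite (eqP cz) raddf0 addr0.
rewrite -[RHS](raddf0 \pi_(homology C k)%qT).
by apply/eqP; rewrite -Quotient.idealrBE subr0.
Qed.

Lemma freeg_additive_ext (K : choiceType) (V : zmodType)
    (f g : {additive {freeg K / int} -> V}) :
  (forall x, f << x >> = g << x >>) -> forall c, f c = g c.
Proof.
move=> fg c; apply/eqP; rewrite -subr_eq0; apply/eqP; move: c.
by apply: (freeg_eq0 (f := f \- g)) => x /=; rewrite fg subrr.
Qed.

Lemma eq_tuple_nth (T : Type) (x0 : T) n (x y : n.-tuple T) :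
  (forall m, (m < n)%N -> nth x0 x m = nth x0 y m) -> x = y.
Proof.
move=> xy; apply: val_inj; apply: (@eq_from_nth _ x0) => [|m].
  by rewrite !size_tuple.
by rewrite size_tuple; exact: xy.
Qed.

Lemma face0_cons (X : shelfType) n (b : X) (x : n.+1.-tuple X) :
  face ord0 [tuple of b :: x] = x.
Proof.
apply: (eq_tuple_nth (x0 := b)) => m mn.
by rewrite nth_face.
Qed.

Lemma faceS_cons (X : shelfType) n (b : X) (i : 'I_n.+2) (x : n.+2.-tuple X) :
  face (fintype.lift ord0 i) [tuple of b :: x] =
    [tuple of (b ⋆ tnth x i) :: face i x].
Proof.
apply: (eq_tuple_nth (x0 := b)) => m mn.
rewrite nth_face // lift0 /=; case: m mn => [|m] mn /=.
  by rewrite (tnth_nth b).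
by rewrite [RHS](nth_face b) // ltnS.
Qed.

Section Cone.
Variables (X : shelfType) (apex : seq X -> X).

Definition cone_basis n (x : n.+1.-tuple X) : dist_chain X n.+1 :=
  << [tuple of apex x :: x] >>.

Definition cone_chain n : dist_chain X n -> dist_chain X n.+1 :=
  fglift (@cone_basis n).

Lemma cone_chain_is_zmod_morphism n : zmod_morphism (@cone_chain n).
Proof. exact: lift_is_additive. Qed.

HB.instance Definition _ n :=
  GRing.isZmodMorphism.Build (dist_chain X n) (dist_chain X n.+1)
    (@cone_chain n) (@cone_chain_is_zmod_morphism n).

Lemma cone_chainU n (x : n.+1.-tuple X) :
  cone_chain << x >> = << [tuple of apex x :: x] >>.
Proof. by rewrite /cone_chain liftU scale1r. Qed.

Lemma cone_chainZ n a c : @cone_chain n (a *: c) = a *: cone_chain c.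
Proof. by rewrite -[a]intz !scaler_int raddfMz. Qed.

(** The cone on the empty sequence, whose multiples are the chains of the
augmentation term. *)
Definition cone_unit (m : int) : dist_chain X 0 := << m *g [tuple apex [::]] >>.

Lemma cone_unit_is_zmod_morphism : zmod_morphism cone_unit.
Proof. by move=> m p; rewrite /cone_unit freegUB. Qed.

HB.instance Definition _ :=
  GRing.isZmodMorphism.Build int (dist_chain X 0) cone_unit
    cone_unit_is_zmod_morphism.

Definition cone k : {additive aug_chain X k -> aug_chain X k.+1} :=
  match k return {additive aug_chain X k -> aug_chain X k.+1} with
  | 0 => cone_unit
  | n.+1 => @cone_chain n
  end.

(* The second hypothesis is the first one for sequences of length 1, whose
   only face is the empty sequence. *)
Hypothesis apex_face : forall n (i : 'I_n.+2) (x : n.+2.-tuple X),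
  apex x ⋆ tnth x i = apex (face i x).
Hypothesis apex_point : forall y, apex [:: y] ⋆ y = apex [::].

(** The 0th face of the cone on x is x; its (i+1)st face is the cone on
d^i x and carries the opposite of the sign of d^i x in ∂x, so these faces
cancel the cone on ∂x. *)
Lemma cone_homotopy k (c : aug_chain X k.+1) :
  aug_bd X k.+1 (cone k.+1 c) + cone k (aug_bd X k c) = c.
Proof.
case: k c => [|n] /=.
  apply: (freeg_additive_ext
    (f := (@dist_bd X 0 \o @cone_chain 0) \+ (cone_unit \o @deg _))
    (g := idfun)) => x /=.
  rewrite cone_chainU degU dist_bdU !big_ord_recl big_ord0 addr0.
  rewrite expr0 expr1 scale1r scaleN1r face0_cons /cone_unit.
  suff -> : face (fintype.lift ord0 ord0) [tuple of apex x :: x]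
            = [tuple apex [::]] by rewrite subrK.
  case/tupleP: x => y x; rewrite (tuple0 x).
  apply: (eq_tuple_nth (x0 := y)) => -[|//] m1.
  by rewrite nth_face //= apex_point.
apply: (freeg_additive_ext
  (f := (@dist_bd X n.+1 \o @cone_chain n.+1) \+
        (@cone_chain n \o @dist_bd X n))
  (g := idfun)) => x /=.
rewrite cone_chainU !dist_bdU big_ord_recl expr0 scale1r face0_cons.
rewrite raddf_sum -addrA -big_split big1 ?addr0 //= => i _.
rewrite faceS_cons apex_face cone_chainZ cone_chainU /bump add1n exprS mulN1r.
by rewrite scaleNr addNr.
Qed.

Lemma acyclic_of_apex : acyclic (augmented_complex X).
Proof.
apply: (@acyclic_contraction (augmented_complex X) cone) => [m|k c].
  exact: degU.
exact: cone_homotopy.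
Qed.

End Cone.

Lemma foldl_shelf_map (X : shelfType) (b z : X) (s : seq X) :
  foldl shelf_op (b ⋆ z) [seq y ⋆ z | y <- s] = foldl shelf_op b s ⋆ z.
Proof. by elim: s b => //= y s IHs b; rewrite -shelf_opDl IHs. Qed.

Lemma face_take_drop (X : shelfType) n (i : 'I_n.+2) (x : n.+2.-tuple X) :
  face i x = [seq y ⋆ tnth x i | y <- take i x] ++ drop i.+1 x :> seq X.
Proof.
pose x0 := tnth x i; have ix : (i < size x)%N by rewrite size_tuple.
apply: (@eq_from_nth _ x0) => [|m].
  rewrite size_cat size_map size_takel ?(ltnW ix) // size_drop !size_tuple.
  by rewrite subSS subnKC // -ltnS.
rewrite size_tuple => mn; rewrite nth_face // nth_cat size_map size_takel;
  last exact: ltnW.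
case: ltnP => mi.
  rewrite (nth_map x0) ?size_takel ?(ltnW ix) // nth_take //.
  by rewrite (tnth_nth x0 x i).
by rewrite nth_drop addSn subnKC.
Qed.

(** Since right multiplication by x_i is an endomorphism of the shelf, acting
by x_i early is compensated by multiplying the entries it jumps over by x_i. *)
Lemma foldl_face (X : shelfType) n (i : 'I_n.+2) (x : n.+2.-tuple X) (b : X) :
  foldl shelf_op (b ⋆ tnth x i) (face i x) = foldl shelf_op b x.
Proof.
rewrite face_take_drop foldl_cat foldl_shelf_map.
rewrite -[in RHS](cat_take_drop i x) foldl_cat.
by rewrite [drop i x](drop_nth (tnth x i)) ?size_tuple // -tnth_nth.
Qed.

Lemma foldl_set_bij (X : shelfType) (A : set X) :
  (forall x, set_bij A A (fun a => a ⋆ x)) ->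
  forall s : seq X, set_bij A A (fun a => foldl shelf_op a s).
Proof.
move=> A_perm; elim=> [|y s IHs] /=; first by split=> // a Aa; exists a.
exact: (set_bij_comp (A_perm y) IHs).
Qed.

Lemma exists_apex (X : shelfType) (A : set X) :
  A !=set0 -> (forall x, set_bij A A (fun a => a ⋆ x)) ->
  exists2 apex : seq X -> X,
    forall n (i : 'I_n.+2) (x : n.+2.-tuple X),
      apex x ⋆ tnth x i = apex (face i x) &
    forall y, apex [:: y] ⋆ y = apex [::].
Proof.
move=> [a Aa] A_perm; have A_bij := foldl_set_bij A_perm.
have apex_ex (s : seq X) : exists b, A b /\ foldl shelf_op b s = a.
  by case: (A_bij s) => _ _ /(_ a Aa)[b Ab ba]; exists b.
have [apex apexP] := choice apex_ex.
have apex_act b y : A b -> A (b ⋆ y) by case: (A_perm y) => + _ _; apply.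
exists apex => [n i x|y]; last first.
  by rewrite [LHS](apexP [:: y]).2 -[LHS](apexP [::]).2.
(* Both sides lie in A, and face i x sends both to a. *)
have [_ inj _] := A_bij (face i x).
have [Ax xa] := apexP x; have [Af fa] := apexP (face i x).
by apply: inj; rewrite ?inE ?foldl_face ?xa ?fa //; exact: apex_act.
Qed.

Theorem proposition5p12 (X : shelfType) (A : set X) (A_neq0 : A !=set0)
    (A_perm : forall x : X, set_bij A A (fun a : X => a ⋆ x)) :
  acyclic (augmented_complex X).
Proof.
have [apex apex_face apex_point] := exists_apex A_neq0 A_perm.
exact: (acyclic_of_apex apex_face apex_point).
Qed.
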